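(* Let $A$ be a good pseudo-hoop and let $F$ be a filter of $A$. The following are equivalent: (a) $F$ is an involutive filter of $A$; (b) $(y^{-}\rightsquigarrow x^{-})\rightarrow (x\rightarrow y)\in F$ and $(y^{\sim}\rightarrow x^{\sim})\rightsquigarrow (x\rightsquigarrow y)\in F$ for all $x,y\in A$; (c) $(x^{-}\rightsquigarrow y)\rightarrow (y^{\sim}\rightarrow x)\in F$ and $(x^{\sim}\rightarrow y)\rightsquigarrow (y^{-}\rightsquigarrow x)\in F$ for all $x,y\in A$.
   Context: A pseudo-hoop is an algebra $(A,\odot,\rightarrow,\rightsquigarrow,1)$ of type $(2,2,2,0)$ such that for all $x,y,z\in A$: $x\odot 1=1\odot x=x$; $x\rightarrow x=x\rightsquigarrow x=1$; $(x\odot y)\rightarrow z=x\rightarrow(y\rightarrow z)$; $(x\odot y)\rightsquigarrow z=y\rightsquigarrow(x\rightsquigarrow z)$; $(x\rightarrow y)\odot x=(y\rightarrow x)\odot y=x\odot(x\rightsquigarrow y)=y\odot(y\rightsquigarrow x)$. The order is $x\le y$ iff $x\rightarrow y=1$. It is bounded if it has a least element $0$; then $x^-=x\rightarrow 0$, $x^\sim=x\rightsquigarrow 0$, $x^{-\sim}=(x^-)^\sim$, $x^{\sim-}=(x^\sim)^-$. A bounded pseudo-hoop is good if $x^{-\sim}=x^{\sim-}$ for all $x$. A filter is a nonempty $F\subseteq A$ closed under $\odot$ and upward closed; it is involutive if $x^{-\sim}\rightarrow x\in F$ and $x^{\sim-}\rightsquigarrow x\in F$ for all $x\in A$. *)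

(* Defs.v *)
Declare Scope hoop_scope.
Delimit Scope hoop_scope with hoop.

Record pseudoHoop : Type := PseudoHoop {
  carrier :> Type;
  mul : carrier -> carrier -> carrier;
  impl : carrier -> carrier -> carrier;
  impr : carrier -> carrier -> carrier;
  one : carrier;
  mul_one : forall x, mul x one = x;
  one_mul : forall x, mul one x = x;
  impl_refl : forall x, impl x x = one;
  impr_refl : forall x, impr x x = one;
  impl_mul : forall x y z, impl (mul x y) z = impl x (impl y z);
  impr_mul : forall x y z, impr (mul x y) z = impr y (impr x z);
  (* the next three laws are the links of the chain
     (x --> y) * x = (y --> x) * y = x * (x ~~> y) = y * (y ~~> x) *)
  divl_comm : forall x y, mul (impl x y) x = mul (impl y x) y;
  divl_divr : forall x y, mul (impl y x) y = mul x (impr x y);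
  divr_comm : forall x y, mul x (impr x y) = mul y (impr y x)
}.

Arguments mul {p} x y.
Arguments impl {p} x y.
Arguments impr {p} x y.
Arguments one {p}.

Bind Scope hoop_scope with carrier.

Notation "x * y" := (mul x y) : hoop_scope.
Notation "x --> y" := (impl x y) (at level 55, no associativity) : hoop_scope.
Notation "x ~~> y" := (impr x y) (at level 55, no associativity) : hoop_scope.
Notation "1" := one : hoop_scope.

Local Open Scope hoop_scope.

Definition le (A : pseudoHoop) (x y : A) : Prop := x --> y = 1.
Arguments le {A} x y.
Notation "x <= y" := (le x y) : hoop_scope.

Record boundedPseudoHoop : Type := BoundedPseudoHoop {
  hoop_of :> pseudoHoop;
  zero : hoop_of;
  zero_le : forall x : hoop_of, zero <= x
}.

Arguments zero {b}.
Notation "0" := zero : hoop_scope.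

Definition negl (A : boundedPseudoHoop) (x : A) : A := x --> 0.
Definition negr (A : boundedPseudoHoop) (x : A) : A := x ~~> 0.
Arguments negl {A} x.
Arguments negr {A} x.

Notation "x ^-" := (negl x) (at level 1, left associativity, format "x ^-")
  : hoop_scope.
Notation "x ^~" := (negr x) (at level 1, left associativity, format "x ^~")
  : hoop_scope.

Definition good (A : boundedPseudoHoop) : Prop :=
  forall x : A, x^-^~ = x^~^-.

Record is_filter (A : pseudoHoop) (F : A -> Prop) : Prop := IsFilter {
  filter_nonempty : exists x, F x;
  filter_mul : forall x y, F x -> F y -> F (x * y);
  filter_up : forall x y, F x -> x <= y -> F y
}.
Arguments is_filter {A} F.

Record is_involutive_filter (A : boundedPseudoHoop) (F : A -> Prop) : Prop :=
  IsInvolutiveFilter {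
  involutive_is_filter : is_filter F;
  involutive_impl : forall x : A, F (x^-^~ --> x);
  involutive_impr : forall x : A, F (x^~^- ~~> x)
}.
Arguments is_involutive_filter {A} F.

(* Main.v *)
(** By the exchange law, [y^- ~~> x^- = x --> y^-^~] and
    [x^- ~~> y^~^- = y^~ --> x^-^~].  As [y <= y^~^-], the first elements in (b)
    and (c) thus lie above [y^-^~ --> y] and [x^-^~ --> x] respectively; taking
    [x = 1] in (b) and [y = 0] in (c) gives these elements back.  The second
    elements are the first ones of the opposite pseudo-hoop. *)

From Stdlib Require Setoid.
Require Import Defs.

Local Open Scope hoop_scope.

Section PseudoHoop.

Variable A : pseudoHoop.
Implicit Types x y z w : A.

Lemma le_refl x : x <= x.
Proof. apply impl_refl. Qed.

Lemma le_antisym x y : x <= y -> y <= x -> x = y.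
Proof.
  unfold le; intros xy yx.
  rewrite <- (one_mul _ x), <- xy, divl_comm, yx.
  apply one_mul.
Qed.

(** By [impl_mul] both products have the same implication into every [w]; taking each product as [w]
    gives the two inequalities. *)
Lemma mul_assoc x y z : x * (y * z) = (x * y) * z.
Proof.
  assert (E : forall w, (x * (y * z)) --> w = ((x * y) * z) --> w)
    by (intros w; now rewrite !impl_mul).
  apply le_antisym; unfold le; [rewrite E | rewrite <- E]; apply impl_refl.
Qed.

(* With [e = x --> 1] and [f = e --> 1], one finds [1 --> x = e * x],
   [x = f * (e * x)] and [f * e = e]. *)
Lemma one_impl x : 1 --> x = x.
Proof.
  set (e := x --> 1).
  assert (ux : 1 --> x = e * x)
    by now rewrite <- (mul_one _ (1 --> x)), divl_comm.
  assert (ue : 1 --> e = e) by (unfold e; now rewrite <- impl_mul, one_mul).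
  assert (fe : (e --> 1) * e = e) by now rewrite divl_comm, ue, mul_one.
  assert (xu : x --> (e * x) = 1)
    by now rewrite <- ux, <- impl_mul, mul_one, impl_refl.
  rewrite ux, <- fe, <- mul_assoc.
  (* Reading [1] as [x --> x] turns [e --> 1] into [(e * x) --> x], to which [divl_comm] applies. *)
  rewrite <- (impl_refl _ x) at 1.
  rewrite <- impl_mul.
  now rewrite divl_comm, xu, one_mul.
Qed.

Lemma impl_one x : x --> 1 = 1.
Proof.
  assert (E : (x --> 1) * x = x) by now rewrite divl_comm, one_impl, mul_one.
  now rewrite <- E at 1; rewrite impl_mul, impl_refl.
Qed.

(** The chain of divisions gives [x = x * (x ~~> y)], so [x ~~> y] equals
    [(x ~~> y) ~~> (x ~~> y)]. *)
Lemma impr_eq1 x y : x <= y -> x ~~> y = 1.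
Proof.
  intros xy.
  assert (E : x * (x ~~> y) = x)
    by now rewrite <- divl_divr, <- divl_comm, xy, one_mul.
  now rewrite <- E at 1; rewrite impr_mul, impr_refl.
Qed.

Lemma le_divl x y : x <= y -> x = (y --> x) * y.
Proof. intros xy. now rewrite <- divl_comm, xy, one_mul. Qed.

Lemma le_trans x y z : x <= y -> y <= z -> x <= z.
Proof.
  intros xy yz; unfold le.
  now rewrite (le_divl x y xy), impl_mul, yz, impl_one.
Qed.

(** Both sides are implications into [z] from the common value of [(x --> y) * x] and
    [(y --> x) * y]. *)
Lemma impl_swap x y z : (x --> y) --> (x --> z) = (y --> x) --> (y --> z).
Proof. now rewrite <- !impl_mul, divl_comm. Qed.

Lemma impl_le_impl x y z : y <= z -> x --> y <= x --> z.
Proof. intros yz; unfold le. now rewrite impl_swap, yz, impl_one. Qed.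

End PseudoHoop.

(** Kept transparent, so that a result about [op A] is convertible to its mirror image in [A]. *)
Definition op (A : pseudoHoop) : pseudoHoop.
Proof.
  refine (@PseudoHoop A (fun x y => y * x) (fun x y => x ~~> y)
            (fun x y => x --> y) 1 _ _ _ _ _ _ _ _ _).
  - apply one_mul.
  - apply mul_one.
  - apply impr_refl.
  - apply impl_refl.
  - intros x y z; apply impr_mul.
  - intros x y z; apply impl_mul.
  - apply divr_comm.
  - intros x y. now rewrite divr_comm, <- divl_divr, divl_comm.
  - apply divl_comm.
Defined.

Section Residuation.

Variable A : pseudoHoop.
Implicit Types x y z w : A.

Lemma impr_eq1E x y : x ~~> y = 1 <-> x <= y.
Proof. split; [exact (impr_eq1 (op A) x y) | apply impr_eq1]. Qed.

Lemma le_impl x y z : x <= y --> z <-> x * y <= z.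
Proof. unfold le. now rewrite impl_mul. Qed.

Lemma le_impr x y z : y <= x ~~> z <-> x * y <= z.
Proof. now rewrite <- !impr_eq1E, impr_mul. Qed.

Lemma impr_le_impr x y z : y <= z -> x ~~> y <= x ~~> z.
Proof.
  intros yz. apply impr_eq1E.
  exact (impl_le_impl (op A) x y z (impr_eq1 A y z yz)).
Qed.

Lemma le_weaken x y : x <= y --> x.
Proof.
  apply le_impl, le_impr, impr_eq1E. rewrite impr_refl.
  apply impr_eq1, impl_one.
Qed.

Lemma impl_antitone x y z : x <= y -> y --> z <= x --> z.
Proof.
  intros xy. rewrite (le_divl _ x y xy), impl_mul. apply le_weaken.
Qed.

(** After [impl_swap] this is weakening; it bounds from below the elements tested for membership in
    the filter. *)
Lemma impl_le_comp x y z : y --> z <= (x --> y) --> (x --> z).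
Proof. rewrite impl_swap. apply le_weaken. Qed.

(** By residuation, [w] lies below either side exactly when [x * w * y <= z]. *)
Lemma impr_impl_exchange x y z : x ~~> (y --> z) = y --> (x ~~> z).
Proof.
  assert (E : forall w, w <= x ~~> (y --> z) <-> w <= y --> (x ~~> z))
    by (intros w; now rewrite le_impr, !le_impl, le_impr, mul_assoc).
  apply le_antisym; apply E, le_refl.
Qed.

Lemma op_filter (F : A -> Prop) : is_filter F -> @is_filter (op A) F.
Proof.
  intros [F0 FM FU]; split.
  - exact F0.
  - intros x y Fx Fy; now apply FM.
  - intros x y Fx xy. apply (FU x y Fx). now apply impr_eq1E.
Qed.

End Residuation.

Definition bounded_op (A : boundedPseudoHoop) : boundedPseudoHoop :=
  @BoundedPseudoHoop (op A) 0 (fun x => impr_eq1 A 0 x (zero_le A x)).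

Section Filter.

Variables (A : boundedPseudoHoop) (F : A -> Prop).
Hypothesis filterF : is_filter F.

Lemma le_negr_negl (x : A) : x <= x^~^-.
Proof. apply le_impl, le_impr, le_refl. Qed.

Lemma negl_contraposition :
  (forall x : A, F (x^-^~ --> x)) <->
  (forall x y : A, F ((y^- ~~> x^-) --> (x --> y))).
Proof.
  split; intros H.
  - intros x y. unfold negl at 2. rewrite impr_impl_exchange.
    exact (filter_up _ _ filterF _ _ (H y) (impl_le_comp A x y^-^~ y)).
  (* Here [1^-] is [0], so the antecedent becomes [y^-^~]. *)
  - intros y. specialize (H 1 y). unfold negl at 2 in H.
    now rewrite !one_impl in H.
Qed.

Lemma negl_negr_contraposition :
  (forall x : A, F (x^-^~ --> x)) <->
  (forall x y : A, F ((x^- ~~> y) --> (y^~ --> x))).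
Proof.
  split; intros H.
  - intros x y.
    assert (L : x^- ~~> y <= y^~ --> x^-^~).
    { unfold negr at 2. rewrite <- impr_impl_exchange. apply impr_le_impr, le_negr_negl. }
    apply (filter_up _ _ filterF _ _ (H x)).
    (* Compose through [y^~], then shrink the antecedent by [L]. *)
    apply (le_trans _ _ _ _ (impl_le_comp A y^~ x^-^~ x)).
    now apply impl_antitone.
  (* Here [0^~] is [1], and [x^- ~~> 0] is [x^-^~]. *)
  - intros x. specialize (H x 0). unfold negr in H at 1.
    now rewrite impr_refl, one_impl in H.
Qed.

Lemma involutive_filterE :
  is_involutive_filter F <->
  (forall x : A, F (x^-^~ --> x)) /\ (forall x : A, F (x^~^- ~~> x)).
Proof.
  split; [intros [_ Hl Hr] | intros [Hl Hr]]; now split.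
Qed.

End Filter.

Theorem theorem4p15 (A : boundedPseudoHoop) (goodA : good A)
    (F : A -> Prop) (filterF : is_filter F) :
  (is_involutive_filter F <->
     (forall x y : A, F ((y^- ~~> x^-) --> (x --> y)) /\
                      F ((y^~ --> x^~) ~~> (x ~~> y)))) /\
  (is_involutive_filter F <->
     (forall x y : A, F ((x^- ~~> y) --> (y^~ --> x)) /\
                      F ((x^~ --> y) ~~> (y^- ~~> x)))).
Proof.
  assert (filterF' := op_filter A F filterF).
  assert (Bl := negl_contraposition A F filterF).
  (* Over [bounded_op A] the two arrows, hence [^-] and [^~], trade places: [Br] and [Cr] handle the
     second conjuncts. *)
  assert (Br := negl_contraposition (bounded_op A) F filterF').
  assert (Cl := negl_negr_contraposition A F filterF).
  assert (Cr := negl_negr_contraposition (bounded_op A) F filterF').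
  rewrite (involutive_filterE A F filterF).
  split; split.
  - intros [Hl Hr] x y. split; [now apply Bl | exact (proj1 Br Hr x y)].
  - intros H. split.
    + apply Bl; intros x y; apply H.
    + apply Br; intros x y; exact (proj2 (H x y)).
  - intros [Hl Hr] x y. split; [now apply Cl | exact (proj1 Cr Hr x y)].
  - intros H. split.
    + apply Cl; intros x y; apply H.
    + apply Cr; intros x y; exact (proj2 (H x y)).
Qed.
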